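(* Fix $\gamma\in(0,1)$ and $0<R<\gamma$. Consider the one-dimensional discounted LQR problem with dynamics $x_{t+1}=Ax_t+Bu_t$, $(A,B)=(0,1)$, i.e. $x_{t+1}=u_t$, state cost $Q=1$, control cost $R$, discount factor $\gamma$, and the policy class $u_t=\pi_\theta(x_t)=\theta_0x_t+\theta_1F_\delta(x_t)$ with $\theta=(\theta_0,\theta_1)\in\mathbb R^2$ and $F_\delta$ as defined in the context. Then there exist $\delta>0$ and $\epsilon>0$ such that, with initial state distribution $$\mu_0=\tfrac{1-\epsilon}{2}\,\delta_{x_0}+\tfrac{1-\epsilon}{2}\,\delta_{y_0}+\tfrac{\epsilon}{10}\,dx\quad\text{on }(-5,5),\qquad x_0=\min F_\delta^{-1}(a_2),\quad y_0=\min F_\delta^{-1}(a_3),$$ the point $\theta=(0,1)$ is a local minimum of the LQR cost function $$C(\theta)=\int \sum_{t=0}^\infty\gamma^t\big(x_t^2+R\,u_t^2\big)\,d\mu_0,$$ where, in the integrand, $x_t$ is the trajectory generated by $\pi_\theta$ from an initial state distributed according to $\mu_0$ and $u_t=\pi_\theta(x_t)$.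
   Context: For $a\in\mathbb R$ and $r>0$ the tent function is $\Lambda_{a,r}(x)=\frac{x-(a-r)}{r}$ for $x\in[a-r,a]$, $\Lambda_{a,r}(x)=\frac{(a+r)-x}{r}$ for $x\in[a,a+r]$, and $0$ otherwise. For $\delta>0$, $$F_\delta(x)=\omega_0|x|+\sum_{i=1}^3\omega_i\Lambda_{a_i,\delta_i}(x),$$ with $\omega_0=-0.5$, $a_1=-2$, $\delta_1=0.1$, $\omega_1=3$, $a_2=1.5$, $a_3=1.8$, $\delta_2=\delta_3=\delta$, $\omega_2=\omega_3=0.2$. In the expression for $\mu_0$, $\delta_{x_0}$ and $\delta_{y_0}$ denote Dirac masses at $x_0$ and $y_0$ (not the parameter $\delta$). *)

(* Defs.v *)
From HB Require Import structures.
From mathcomp Require Import all_boot all_order all_algebra.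
From mathcomp Require Import all_classical all_reals all_analysis.
From mathcomp Require Import lra.

Set Implicit Arguments.
Unset Strict Implicit.
Unset Printing Implicit Defensive.

Import Order.TTheory GRing.Theory Num.Theory.
Import numFieldNormedType.Exports.

Local Open Scope classical_set_scope.
Local Open Scope ring_scope.

(* [minimums A x] means that [x] is the (unique) least element of [A]; compare
   [infimums]. *)
Definition minimums (R : realType) (A : set R) : set R := A `&` lbound A.

Definition local_minimum (R : realType) (T : topologicalType) (f : T -> \bar R)
    (x : T) : Prop :=
  \forall y \near x, (f x <= f y)%E.

Section one_dimensional_LQR.
Context (R : realType).
Implicit Types (A B Q Rc g : R) (pi : R -> R).

Definition lqr_state A B pi (x : R) (t : nat) : R :=
  iter t (fun z => A * z + B * pi z) x.

(* The integrand is nonnegative for Q, Rc, g >= 0; the cost of a policy may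
   then be [+oo]. *)
Definition lqr_cost A B Q Rc g pi
    (mu : {measure set (measurableTypeR R) -> \bar R}) : \bar R :=
  \int[mu]_x \sum_(0 <= t <oo)
    (g ^+ t * (Q * lqr_state A B pi x t ^+ 2
               + Rc * pi (lqr_state A B pi x t) ^+ 2))%:E.

End one_dimensional_LQR.

Section policy_class.
Context (R : realType).

Definition tent (a r x : R) : R :=
  if a - r <= x <= a then (x - (a - r)) / r
  else if a <= x <= a + r then ((a + r) - x) / r
  else 0.

Definition om0 : R := - (1 / 2).
Definition a1 : R := - 2.
Definition delta1 : R := 1 / 10.
Definition om1 : R := 3.
Definition a2 : R := 3 / 2.
Definition a3 : R := 9 / 5.
Definition om2 : R := 1 / 5.
Definition om3 : R := 1 / 5.

Definition Fdelta (delta x : R) : R :=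
  om0 * `|x| + (om1 * tent a1 delta1 x + om2 * tent a2 delta x
                + om3 * tent a3 delta x).

Definition policy (delta : R) (theta : R * R) (x : R) : R :=
  theta.1 * x + theta.2 * Fdelta delta x.

End policy_class.
Arguments a2 {R}.
Arguments a3 {R}.

Section initial_distribution.
Context (R : realType) (eps : {i01 R}) (x0 y0 : R).
Local Notation T := (measurableTypeR R).

Definition mu0 : set T -> \bar R :=
  measure_add
    (measure_add
      (mscale ((1 - eps%:num) / 2)%:nng (dirac (x0 : T)))
      (mscale ((1 - eps%:num) / 2)%:nng (dirac (y0 : T))))
    (mscale (eps%:num / 10)%:nng
      (mrestr lebesgue_measure (measurable_itv `]-5, 5[))).

HB.instance Definition _ := Measure.on mu0.

Lemma mu0_setT : mu0 [set: T] = 1%E.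
Proof.
rewrite /mu0 /measure_add /= /msum !big_ord_recr !big_ord0 /= !add0e.
rewrite /measure_add /= /msum !big_ord_recr !big_ord0 /= !add0e.
rewrite /mscale /= !diracT /mrestr setTI lebesgue_measure_itv /= lte_fin.
rewrite ifT; last by rewrite -subr_gt0 opprK addr_gt0.
rewrite !mule1 -EFinB -EFinM -!EFinD; congr (_%:E).
lra.
Qed.

HB.instance Definition _ := Measure_isProbability.Build _ _ _ mu0 mu0_setT.

End initial_distribution.

(* Main.v *)
(* At [theta = (0, 1)] the trajectories from [x0] and [y0] hit the peaks [a2]
   and [a3] at time 1. A perturbation at distance d from (0, 1) moves these two
   points by D1 and D2 with d <= 7 (|D1| + |D2|), since (x0, a2) and (y0, a3)
   are linearly independent. Leaving a peak lowers [F] by |Di| / (5 delta),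
   which increases x_2^2 by at least a multiple of |Di| / delta, whereas every
   other term of the cost decreases by at most O(d), uniformly in delta; a small
   delta makes the gain dominate. From any other start in (-5, 5) the trajectory
   enters, after three steps, an interval where [F] is a contraction, so its
   cost is Lipschitz in theta with a constant depending on delta only, and a
   small eps makes this part negligible. *)
Require Import Defs.
From mathcomp Require Import all_boot all_order all_algebra.
From mathcomp Require Import all_classical all_reals all_analysis.
From mathcomp Require Import measurable_realfun ring lra.

Set Implicit Arguments.
Unset Strict Implicit.
Unset Printing Implicit Defensive.

Import Order.TTheory GRing.Theory Num.Theory.
Import numFieldNormedType.Exports.
Local Open Scope classical_set_scope.
Local Open Scope ring_scope.

(** * Elementary properties of the tent function *)

Section tent_lemmas.
Context (R : realType) (r : R) (hr : 0 < r).
Implicit Types a x y : R.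

(** This form has no case split; the values, the Lipschitz constant and the measurability of the
    tent are all read off from it. *)
Lemma tentE a x : tent a r x = Num.max 0 (1 - `|x - a| / r).
Proof.
have r1 : r * r^-1 = 1 by rewrite mulfV// gt_eqF.
rewrite /tent; case: ifPn => [/andP[h1 h2]|h].
  rewrite ler0_norm ?subr_le0// max_r; first by lra.
  rewrite subr_ge0 ler_pdivrMr//; lra.
case: ifPn => [/andP[h1 h2]|h'].
  rewrite ger0_norm ?subr_ge0// max_r; first by lra.
  rewrite subr_ge0 ler_pdivrMr//; lra.
rewrite max_l// subr_le0 ler_pdivlMr// mul1r.
rewrite ler_normr; apply/orP; move: h h'.
case: (lerP (a - r) x) => ?; case: (lerP a x) => ?; case: (lerP x a) => ? //=;
  rewrite -?ltNge => *; by [left; lra | right; lra].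
Qed.

Lemma tent_ge0 a x : 0 <= tent a r x.
Proof. by rewrite tentE le_max lexx. Qed.

Lemma tent_le1 a x : tent a r x <= 1.
Proof. by rewrite tentE ge_max ler01 lerBlDr lerDl divr_ge0// ltW. Qed.

Lemma tent_in a x : `|x - a| <= r -> tent a r x = 1 - `|x - a| / r.
Proof. by move=> h; rewrite tentE max_r// subr_ge0 ler_pdivrMr// mul1r. Qed.

Lemma tent_out a x : r <= `|x - a| -> tent a r x = 0.
Proof. by move=> h; rewrite tentE max_l// subr_le0 ler_pdivlMr// mul1r. Qed.

Lemma tent_lip a x y : `|tent a r x - tent a r y| <= r^-1 * `|x - y|.
Proof.
have max_lip (u v : R) : `|Num.max 0 u - Num.max 0 v| <= `|u - v|.
  have := ler_norm (u - v); have := ler_norm (v - u); rewrite (distrC v).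
  have := normr_ge0 (u - v); rewrite ler_norml.
  by case: (leP 0 u) => ?; case: (leP 0 v) => ? *; apply/andP; lra.
rewrite !tentE (le_trans (max_lip _ _))//.
have -> : 1 - `|x - a| / r - (1 - `|y - a| / r) = r^-1 * (`|y - a| - `|x - a|).
  by ring.
rewrite normrM gtr0_norm ?invr_gt0// ler_pM2l ?invr_gt0//.
rewrite (le_trans (ler_dist_dist _ _))// distrC [leLHS](_ : _ = `|x - y|)//.
by congr `|_|; ring.
Qed.

End tent_lemmas.

(** * Shape, bounds and Lipschitz constant of [F] *)

Section Fdelta_lemmas.
Context (R : realType) (delta : R) (hd : 0 < delta <= 1 / 10).
Implicit Types x y : R.
Notation F := (Fdelta delta).

Let d0 : 0 < delta. Proof. by case/andP: hd. Qed.
Let dle : delta <= 1 / 10. Proof. by case/andP: hd. Qed.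
Let d1 : 0 < delta1 R. Proof. by rewrite /delta1; lra. Qed.

Let Fdelta_out x : delta1 R <= `|x - a1 R| -> delta <= `|x - a2| ->
  delta <= `|x - a3| -> F x = - (`|x| / 2).
Proof.
by move=> h1 h2 h3; rewrite /Fdelta !tent_out// /om0; lra.
Qed.

Lemma Fdelta_ge x : - (`|x| / 2) <= F x.
Proof.
rewrite /Fdelta /om0 /om1 /om2 /om3.
have := tent_ge0 d1 (a1 R) x; have := tent_ge0 d0 a2 x.
by have := tent_ge0 d0 a3 x; lra.
Qed.

(** All three tents vanish here: [delta <= 1 / 10] keeps the support of the tent at [a2] to the
    right of 7/5. *)
Lemma Fdelta_eq x : - (3 / 2) <= x <= 7 / 5 -> F x = - (`|x| / 2).
Proof.
have hd1 := dle; move=> hx; apply: Fdelta_out; rewrite ler_normr /delta1 /a1 /a2 /a3;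
  apply/orP.
- by left; lra.
- by right; lra.
- by right; lra.
Qed.

(** Where the tall tent is active, [|x| >= 19 / 10] and its height 3 give 3 - 19/20 = 41/20;
    elsewhere the two small tents contribute at most 2/5. *)
Lemma Fdelta_le x : F x <= 41 / 20.
Proof.
have hd1 := dle.
rewrite /Fdelta /om0 /om1 /om2 /om3.
have := tent_le1 d1 (a1 R) x; have := tent_le1 d0 a2 x.
have := tent_le1 d0 a3 x; have := normr_ge0 x.
have [h|h] := lerP (delta1 R) `|x - a1 R|.
  by rewrite (tent_out d1 h); lra.
move: h; rewrite lter_norml /delta1 /a1 => /andP[h1 h2].
rewrite (@tent_out _ _ d0 a2) ?(@tent_out _ _ d0 a3); last 2 first.
- by rewrite ler_normr /a3; apply/orP; right; lra.
- by rewrite ler_normr /a2; apply/orP; right; lra.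
by rewrite ler0_norm; lra.
Qed.

Lemma Fdelta_le0 x : - (3 / 2) <= x -> F x <= 0.
Proof.
have hd1 := dle; move=> hx; have [h|h] := lerP x (7 / 5).
  by rewrite Fdelta_eq ?hx// oppr_le0 divr_ge0.
rewrite /Fdelta /om0 /om1 /om2 /om3 (tent_out d1); last first.
  by rewrite ler_normr /delta1 /a1; apply/orP; left; lra.
have := tent_le1 d0 a2 x; have := tent_le1 d0 a3 x.
by rewrite ger0_norm; lra.
Qed.

Lemma Fdelta_far x : x <= - (21 / 10) -> F x <= 0.
Proof.
have hd1 := dle; move=> hx; rewrite Fdelta_out ?oppr_le0 ?divr_ge0// ler_normr /a1 /a2 /a3 /delta1;
  apply/orP; right; lra.
Qed.

(** The slope is 30 from the tall tent plus 1/2 from [- |x| / 2]. The points [x0] and [y0] lie on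
    this branch. *)
Lemma Fdelta_rise x : - (21 / 10) <= x <= - 2 -> F x = 61 / 2 * x + 63.
Proof.
have hd1 := dle; move=> /andP[x1 x2]; rewrite /Fdelta.
rewrite (@tent_out _ _ d0 a2) ?(@tent_out _ _ d0 a3); last 2 first.
- by rewrite ler_normr /a3; apply/orP; right; lra.
- by rewrite ler_normr /a2; apply/orP; right; lra.
rewrite (tent_in d1); last by rewrite ler_norml /a1 /delta1; lra.
rewrite /om0 /om1 /a1 /delta1 ler0_norm; last by lra.
by rewrite ler0_norm; last lra; field.
Qed.

(** The two narrow tents have disjoint supports, because [a3 - a2] = 3/10 exceeds [2 * delta]. *)
Lemma Fdelta_peak (a : R) x : a \in [:: a2; a3] -> `|x - a| <= delta ->
  F x = - (x / 2) + 1 / 5 * (1 - `|x - a| / delta).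
Proof.
have hd1 := dle.
rewrite !inE => ha hx; move: (hx); rewrite ler_norml => /andP[h1 h2].
rewrite /Fdelta (tent_out d1); last first.
  by rewrite ler_normr; apply/orP; left; move: ha h1;
    rewrite /a1 /delta1 => /orP[]/eqP->; rewrite /a2 /a3; lra.
rewrite (@ger0_norm _ x); last by move: ha h1 => /orP[]/eqP->; rewrite /a2 /a3; lra.
case/orP: ha => /eqP ?; subst a; rewrite (tent_in d0 hx).
  rewrite (@tent_out _ _ d0 a3) /om0 /om2; first by lra.
  by rewrite ler_normr; apply/orP; right; move: h2; rewrite /a2 /a3; lra.
rewrite (@tent_out _ _ d0 a2) /om0 /om3; first by lra.
by rewrite ler_normr; apply/orP; left; move: h1; rewrite /a2 /a3; lra.
Qed.

(** The slopes add up to 1/2 + 3 * 10 + 2 / (5 delta), rounded up. *)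
Lemma Fdelta_lip x y : `|F x - F y| <= (31 + delta^-1) * `|x - y|.
Proof.
have := tent_lip d1 (a1 R) x y; have := tent_lip d0 a2 x y.
have := tent_lip d0 a3 x y; have := ler_dist_dist x y.
have : 0 <= delta^-1 * `|x - y| by rewrite mulr_ge0// invr_ge0 ltW.
have -> : (delta1 R)^-1 = 10 by rewrite /delta1 mul1r invrK.
have := normr_ge0 (x - y).
rewrite !ler_norml /Fdelta /om0 /om1 /om2 /om3.
by move=> *; apply/andP; lra.
Qed.

End Fdelta_lemmas.

(** * Trajectories of perturbed policies *)

Section trajectories.
Context (R : realType) (delta : R) (hd : 0 < delta <= 1 / 10).
Implicit Types (x y : R) (theta : R * R) (t : nat).
Notation F := (Fdelta delta).

Definition pdist theta : R := `|theta.1| + `|theta.2 - 1|.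

Definition traj theta x t : R := lqr_state 0 1 (policy delta theta) x t.

Lemma traj0 theta x : traj theta x 0 = x. Proof. by []. Qed.

Lemma trajS theta x t :
  traj theta x t.+1 = policy delta theta (traj theta x t).
Proof. by rewrite /traj /lqr_state iterS mul0r add0r mul1r. Qed.

Lemma pdist_ge0 theta : 0 <= pdist theta. Proof. exact: addr_ge0. Qed.

Lemma pdist_ref : pdist (0, 1) = 0.
Proof. by rewrite /pdist/= subrr normr0 addr0. Qed.

Lemma policy_ref x : policy delta (0, 1) x = F x.
Proof. by rewrite /policy/= mul0r mul1r add0r. Qed.

Lemma policy_near theta x m : `|x| <= m -> `|F x| <= m ->
  `|policy delta theta x - F x| <= m * pdist theta.
Proof.
move=> hx hF; rewrite /policy /pdist.
have -> : theta.1 * x + theta.2 * F x - F x = theta.1 * x + (theta.2 - 1) * F x.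
  by ring.
rewrite (mulrDr m) (le_trans (ler_normD _ _))// !normrM lerD//.
  by rewrite mulrC ler_wpM2r.
by rewrite mulrC ler_wpM2r.
Qed.

Lemma Fdelta_bound x : `|x| <= 5 -> `|F x| <= 5.
Proof.
move=> hx; rewrite ler_norml; have := Fdelta_ge hd x; have := Fdelta_le hd x.
by move=> *; apply/andP; lra.
Qed.

Section perturbation.
Context (theta : R * R) (hth : pdist theta <= 1 / 100).

Lemma policy_range x : `|x| <= 5 ->
  F x - 1 / 20 <= policy delta theta x <= F x + 1 / 20.
Proof.
move=> hx; have := policy_near theta hx (Fdelta_bound hx).
by have := hth; rewrite ler_norml => *; lra.
Qed.

(** [F] maps this interval into [-11/20, 0], which leaves room for the perturbation of at most
    1/20. *)
Lemma policy_contract x : - (11 / 10) <= x <= 1 / 20 ->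
  - (11 / 10) <= policy delta theta x <= 1 / 20.
Proof.
move=> hx; have : `|x| <= 11 / 10 by rewrite ler_norml; lra.
have x32 : - (3 / 2) <= x by lra.
have x5 : `|x| <= 5 by rewrite ler_norml; lra.
have := policy_range x5; have := Fdelta_ge hd x; have := Fdelta_le0 hd x32.
by move=> *; lra.
Qed.

(* Three steps suffice to reach an interval on which [F x = - |x| / 2]: they
   lead from [-5, 5] to [-2.55, 2.1], to [-1.325, 2.1], to [-1.1, 0.05]. *)
Lemma traj_late x t : `|x| <= 5 ->
  - (11 / 10) <= traj theta x (t + 3) <= 1 / 20.
Proof.
move=> x5; elim: t => [|t ih]; last by rewrite addSn trajS policy_contract.
rewrite add0n 3!trajS traj0; set x1 := policy _ _ x; set x2 := policy _ _ x1.
have [l1 u1] : - (51 / 20) <= x1 /\ x1 <= 21 / 10.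
  have := policy_range x5; have := Fdelta_ge hd x; have := Fdelta_le hd x.
  by rewrite -/x1 => *; lra.
have n1 : `|x1| <= 51 / 20 by rewrite ler_norml; lra.
have x15 : `|x1| <= 5 by lra.
have [l2 u2] : - (53 / 40) <= x2 /\ x2 <= 21 / 10.
  have := policy_range x15; have := Fdelta_ge hd x1; have := Fdelta_le hd x1.
  by rewrite -/x2 => *; lra.
have n2 : `|x2| <= 21 / 10 by rewrite ler_norml; lra.
have x25 : `|x2| <= 5 by lra.
have x232 : - (3 / 2) <= x2 by lra.
have := policy_range x25; have := Fdelta_ge hd x2.
by have := Fdelta_le0 hd x232 => *; lra.
Qed.

Lemma traj_bound x t : `|x| <= 5 -> `|traj theta x t| <= 5.
Proof.
move=> x5; have step z : `|z| <= 5 -> `|policy delta theta z| <= 5.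
  move=> z5; have := policy_range z5; have := Fdelta_ge hd z.
  by have := Fdelta_le hd z => *; rewrite ler_norml; lra.
by elim: t => // t ih; rewrite trajS step.
Qed.

End perturbation.

(** A Lipschitz constant of [F] enlarged by one; the extra unit absorbs the error [5 * d] committed
    at each step. *)
Definition lipF : R := 32 + delta^-1.

Lemma lipF_ge1 : 1 <= lipF.
Proof.
have : 0 <= delta^-1 by rewrite invr_ge0; case/andP: hd => /ltW.
by rewrite /lipF; lra.
Qed.

(** The error bound grows by the factor [lipF] during three steps. From then on both trajectories
    lie where [F] halves distances, so the bound is uniform in time. *)
Lemma traj_lip theta x t : pdist theta <= 1 / 100 -> `|x| <= 5 ->
  `|traj theta x t - traj (0, 1) x t| <= 10 * lipF ^+ 3 * pdist theta.
Proof.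
move=> hth x5; set d := pdist theta; have d0 : 0 <= d := pdist_ge0 theta.
have ref : pdist (0, 1) <= 1 / 100 :> R by rewrite pdist_ref; lra.
have near_ref s : `|traj theta x s.+1 - F (traj theta x s)| <= 5 * d.
  have h := traj_bound hth s x5.
  by rewrite trajS policy_near// Fdelta_bound.
have L1 := lipF_ge1.
have early s : `|traj theta x s - traj (0, 1) x s| <= 10 * lipF ^+ s * d.
  elim: s => [|s ih]; first by rewrite !traj0 subrr normr0 expr0 mulr1 mulr_ge0.
  have Ls : 1 <= lipF ^+ s by rewrite exprn_ege1.
  have := near_ref s.
  have := Fdelta_lip hd (traj theta x s) (traj (0, 1) x s).
  rewrite [traj (0, 1) x s.+1]trajS policy_ref.
  have -> : 31 + delta^-1 = lipF - 1 by rewrite /lipF; lra.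
  have h : (lipF - 1) * `|traj theta x s - traj (0, 1) x s| <=
      (lipF - 1) * (10 * lipF ^+ s * d).
    by rewrite ler_wpM2l// subr_ge0.
  have hLd : d <= lipF ^+ s * d by rewrite ler_peMl.
  have := ler_distD (F (traj theta x s)) (traj theta x s.+1) (F (traj (0, 1) x s)).
  by rewrite exprS; move: h hLd; nra.
have traj_small (z : R) : - (11 / 10) <= z <= 1 / 20 -> - (3 / 2) <= z <= 7 / 5.
  by move=> *; lra.
have [t3|t3] := leqP t 3.
  rewrite (le_trans (early t))// ler_wpM2r// ler_wpM2l//.
  by rewrite ler_weXn2l.
rewrite -(subnK (ltnW t3)); elim: (t - 3)%N => [|s ih].
  by rewrite add0n early.
(* Halving the old error frees [5 * lipF ^+ 3 * d], enough for the new error [5 * d]. *)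
have L3 : 1 <= lipF ^+ 3 by rewrite exprn_ege1.
have hLd : d <= lipF ^+ 3 * d by rewrite ler_peMl.
have l1 := traj_late hth s x5.
have l2 := traj_late ref s x5.
have F1 := Fdelta_eq hd (traj_small _ l1).
have F2 := Fdelta_eq hd (traj_small _ l2).
have := near_ref (s + 3)%N.
rewrite addSn [traj (0, 1) x _.+1]trajS policy_ref F1 F2.
have := ler_dist_dist (traj theta x (s + 3)) (traj (0, 1) x (s + 3)).
by rewrite !ler_norml => *; lra.
Qed.

End trajectories.
Arguments traj : simpl never.

(** * Comparison of stage costs and discounted costs *)

Section stage_costs.
Context (R : realType) (delta g Rc : R) (hd : 0 < delta <= 1 / 10)
  (hg : 0 < g < 1) (hRc : 0 < Rc < g).
Implicit Types (x : R) (theta : R * R) (t : nat).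
Notation F := (Fdelta delta).
Notation traj := (traj delta).

(** The factor 1 is the weight Q; keeping it makes the summand convertible to that of [lqr_cost]. *)
Definition stage theta x t : R :=
  g ^+ t * (1 * traj theta x t ^+ 2 + Rc * policy delta theta (traj theta x t) ^+ 2).

Lemma stage_ge0 theta x t : 0 <= stage theta x t.
Proof.
case/andP: hg => g0 _; case/andP: hRc => Rc0 _.
apply: mulr_ge0; first by rewrite exprn_ge0// ltW.
by rewrite addr_ge0// mulr_ge0 ?sqr_ge0// ltW.
Qed.

(** Since A = 0 and B = 1, the control at time t is the state at time t + 1. Thus [K] enters once
    with weight 1 and once with weight [Rc <= 1]. *)
Lemma stage_le_traj theta theta' x t (e K : R) : 0 <= K ->
  traj theta x t ^+ 2 + e <= traj theta' x t ^+ 2 + K ->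
  traj theta x t.+1 ^+ 2 <= traj theta' x t.+1 ^+ 2 + K ->
  stage theta x t + g ^+ t * e <= stage theta' x t + g ^+ t * (2 * K).
Proof.
move=> K0; rewrite /stage -!trajS -!mulrDr => h h'.
rewrite ler_wpM2l//; first by case/andP: hg => g0 _; rewrite exprn_ge0// ltW.
case/andP: hRc => Rc0 Rcg; case/andP: hg => _ g1.
have RcK : Rc * K <= K by rewrite ler_piMl//; lra.
by have := ler_wpM2l (ltW Rc0) h'; lra.
Qed.

(** States stay in [-5, 5], so their squares differ by at most 10 times their distance; with
    [traj_lip] and the doubling this gives 200 = 2 * 10 * 10. *)
Lemma stage_lip theta x t : pdist theta <= 1 / 100 -> `|x| <= 5 ->
  stage (0, 1) x t <=
    stage theta x t + g ^+ t * (200 * lipF delta ^+ 3 * pdist theta).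
Proof.
move=> hth x5.
have ref : pdist (0, 1) <= 1 / 100 :> R by rewrite pdist_ref; lra.
have sq s : traj (0, 1) x s ^+ 2 <=
    traj theta x s ^+ 2 + 10 * (10 * lipF delta ^+ 3 * pdist theta).
  have := traj_lip hd s hth x5; have := traj_bound hd hth s x5.
  have := traj_bound hd ref s x5; move: (traj _ _ _) (traj _ _ _) => y z y5 z5 h.
  have -> : z ^+ 2 = y ^+ 2 + (- (z + y)) * (y - z) by ring.
  rewrite lerD2l (le_trans (ler_norm _))// normrM normrN ler_pM//.
  by rewrite (le_trans (ler_normD _ _))//; lra.
have K0 : 0 <= 10 * (10 * lipF delta ^+ 3 * pdist theta).
  have L1 := lipF_ge1 hd; have L0 : 0 <= lipF delta by lra.
  by rewrite !mulr_ge0 ?pdist_ge0 ?exprn_ge0.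
have := @stage_le_traj (0, 1) theta x t 0 _ K0.
rewrite !addr0 mulr0 addr0 => /(_ (sq _) (sq _)) /le_trans; apply.
by rewrite lerD2l [leRHS](_ : _ = g ^+ t *
  (2 * (10 * (10 * lipF delta ^+ 3 * pdist theta))))//; ring.
Qed.

(* The trajectory reaches the peak [a] after one step and is negative
   afterwards; the depth of the tent at [a] then shows at first order in
   [x_2]. *)
Lemma traj_peak theta (a x : R) t : a \in [:: a2; a3] -> F x = a -> `|x| <= 3 ->
  pdist theta <= 1 / 100 -> pdist theta <= delta / 100 ->
  traj (0, 1) x t ^+ 2 +
    (if t == 2%N then `|traj theta x 1 - a| / delta / 10 else 0) <=
  traj theta x t ^+ 2 + 12 * pdist theta.
Proof.
move=> ha Fx x3; have := pdist_ge0 theta.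
have : `|theta.2 - 1| <= pdist theta by rewrite lerDr.
have : `|theta.1| <= pdist theta by rewrite lerDl.
have := @policy_near _ delta theta x 3 x3.
move: (pdist theta) => d x1a p1 p2 d0 h1 h2; set q := _ / delta.
have del0 : 0 < delta by case/andP: hd.
have a_ge : 3 / 2 <= a by move: ha; rewrite !inE => /orP[]/eqP->; rewrite /a2 /a3; lra.
have a_le : a <= 9 / 5 by move: ha; rewrite !inE => /orP[]/eqP->; rewrite /a2 /a3; lra.
have prod_le (u v c : R) : `|u| <= d -> `|v| <= c -> `|u * v| <= c * d.
  by move=> *; rewrite normrM mulrC ler_pM.
have {}x1a : `|traj theta x 1 - a| <= 3 * d.
  by rewrite trajS traj0 -[X in _ - X]Fx x1a// Fx ger0_norm; lra.
have q0 : 0 <= q by rewrite divr_ge0// ltW.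
have q3 : q <= 3 / 100.
  by rewrite ler_pdivrMr//; lra.
have Fx1 : F (traj theta x 1) = - (traj theta x 1 / 2) + 1 / 5 * (1 - q).
  by rewrite (Fdelta_peak hd ha)//; lra.
have Fa : F a = - (a / 2) + 1 / 5.
  by rewrite (Fdelta_peak hd ha) subrr normr0 ?mul0r ?subr0 ?mulr1// ltW.
have ref1 : traj (0, 1) x 1 = a by rewrite trajS policy_ref.
have ref2 : traj (0, 1) x 2 = - (a / 2) + 1 / 5 by rewrite trajS ref1 policy_ref.
case: t => [|[|t]]; first by rewrite !traj0 addr0 lerDl mulr_ge0.
  (* At time 1 the loss is at most 2 a * 3 d, which is below 12 d as [a <= 9 / 5]. *)
  rewrite ref1 addr0 /=; move: x1a; rewrite ler_norml => /andP[l u].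
  have : 0 <= (traj theta x 1 - a) ^+ 2 by exact: sqr_ge0.
  have : a * (- (3 * d)) <= a * (traj theta x 1 - a) by rewrite ler_wpM2l//; lra.
  have : a * d <= 9 / 5 * d by rewrite ler_wpM2r.
  by rewrite sqrrB !expr2; lra.
(* [y] and [z] stand for [- x_(t+2)] along [theta] and along [(0, 1)]. *)
have sq (y z e : R) : 0 <= z <= 7 / 10 -> z + e - 5 * d <= y ->
    z ^+ 2 + 2 * z * e <= y ^+ 2 + 7 * d.
  move=> /andP[z0 z7] h.
  have : 0 <= (y - z) ^+ 2 by exact: sqr_ge0.
  have : z * (e - 5 * d) <= z * (y - z) by rewrite ler_wpM2l//; lra.
  have : z * d <= 7 / 10 * d by rewrite ler_wpM2r.
  by rewrite sqrrB !expr2; lra.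
(* The lowered tent contributes q/5, of which q/10 is kept. The error is at most 3/2 d from
   [x1 / 2], 2 d from [theta.1] and d from [theta.2]. *)
have start : 0 <= - traj theta x 2 <= 1 /\
    - traj (0, 1) x 2 + q / 10 - 5 * d <= - traj theta x 2.
  rewrite trajS ref2 /policy Fx1; move: x1a q3 q0.
  rewrite ler_norml; set x1 := traj theta x 1 => /andP[l u] q3 q0.
  have := @prod_le _ x1 2 p1.
  have := @prod_le _ (x1 / 2 - 1 / 5 + 1 / 5 * q) 1 p2.
  rewrite !ler_norml => i1 i2.
  have /i1/andP[i3 i4] : -1 <= x1 / 2 - 1 / 5 + 1 / 5 * q <= 1.
    by lra.
  have /i2/andP[i5 i6] : -2 <= x1 <= 2 by lra.
  by split; [apply/andP; split|]; lra.
(* On negative states [F] halves, so the lag 5 d becomes 5/2 d plus at most 3/2 d of new error and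
   never exceeds 5 d. *)
have cone n : [/\ 0 <= - traj theta x n.+2 <= 1,
    0 <= - traj (0, 1) x n.+2 <= 7 / 10 &
    - traj (0, 1) x n.+2 - 5 * d <= - traj theta x n.+2].
  elim: n => [|n [y01 z07 yz]].
    by case: start => s1 s2; split => //; [rewrite ref2; lra|lra].
  rewrite ![traj _ x n.+3]trajS policy_ref.
  move: y01 z07 yz; set y := traj theta x _; set z := traj _ x _.
  move=> y01 z07 yz.
  clear start sq Fx1 Fa ref1 ref2 x1a q0 q3 q a_ge a_le.
  rewrite (Fdelta_eq hd (x := z)); last lra.
  rewrite /policy (Fdelta_eq hd (x := y)); last lra.
  rewrite (ler0_norm (x := z)); last lra.
  rewrite (ler0_norm (x := y)); last lra.
  have y1 : `|- y| <= 1 by rewrite ger0_norm; lra.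
  (* A bound relative to [y], not only to [d], is what preserves the sign of the state. *)
  have small (u : R) : `|u| <= d -> `|u * - y| <= 1 / 100 * - y.
    by move=> hu; rewrite normrM (@ger0_norm _ (- y)) ?ler_wpM2r//; lra.
  have := prod_le _ _ _ p1 y1; have := prod_le _ _ _ p2 y1.
  have := small _ p1; have := small _ p2; rewrite !ler_norml => *.
  by split; [apply/andP; split| |]; lra.
case: t => [|t] /=.
  case: start => s1 s2; have [_ z07 _] := cone 0%N.
  have := sq _ _ _ z07 s2; rewrite !sqrrN.
  (* The reference state satisfies [a / 2 - 1 / 5 >= 11 / 20], so the cross term 2 z * q/10 is at
     least q/10. *)
  have : q * (11 / 20) <= q * (- traj (0, 1) x 2).
    by rewrite ler_wpM2l// ref2; lra.
  by lra.
have [_ z07 yz] := cone t.+1.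
have := sq _ _ 0 z07; rewrite addr0 => /(_ _ yz).
by rewrite !sqrrN; lra.
Qed.

Lemma stage_peak theta (a x : R) t : a \in [:: a2; a3] -> F x = a -> `|x| <= 3 ->
  pdist theta <= 1 / 100 -> pdist theta <= delta / 100 ->
  stage (0, 1) x t +
    (if t == 2%N then g ^+ 2 * (`|traj theta x 1 - a| / delta / 10) else 0) <=
  stage theta x t + g ^+ t * (24 * pdist theta).
Proof.
move=> ha Fx x3 h1 h2; set q := _ / delta / 10.
have q0 : 0 <= q by case/andP: hd => /ltW del0 _; rewrite !divr_ge0.
have K0 : 0 <= 12 * pdist theta by rewrite mulr_ge0 ?pdist_ge0.
(* The control at time 1 is also [x_2]; the gain it brings is discarded. *)
have hS : traj (0, 1) x t.+1 ^+ 2 <= traj theta x t.+1 ^+ 2 + 12 * pdist theta.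
  rewrite (le_trans _ (traj_peak t.+1 ha Fx x3 h1 h2))// lerDl.
  by case: ifP.
have := stage_le_traj K0 (traj_peak t ha Fx x3 h1 h2) hS.
have -> : 24 * pdist theta = 2 * (12 * pdist theta) by ring.
rewrite -/q; case: ifP => [/eqP->|_] //.
by rewrite mulr0.
Qed.

Definition disc_cost theta x : \bar R := (\sum_(0 <= t <oo) (stage theta x t)%:E)%E.

Lemma nneseries_geometric_le (K : R) : 0 <= K ->
  (\sum_(0 <= t <oo) (g ^+ t * K)%:E <= (K / (1 - g))%:E)%E.
Proof.
move=> K0; case/andP: hg => g0 g1.
have gK t : (0 <= (g ^+ t * K)%:E)%E by rewrite lee_fin mulr_ge0// exprn_ge0// ltW.
apply: lime_le; first exact: is_cvg_nneseries.
apply: nearW => n; rewrite sumEFin lee_fin.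
have -> : \sum_(0 <= t < n) g ^+ t * K = series (geometric K g) n.
  by apply: eq_bigr => i _; rewrite mulrC.
by apply: geometric_le_lim => //; rewrite ger0_norm// ltW.
Qed.

(** Both sides are kept additive because the costs are extended reals; the gain [G] enters as a
    series with a single nonzero term. *)
Lemma disc_cost_le theta theta' x (n : nat) (G K : R) : 0 <= G -> 0 <= K ->
  (forall t, stage theta x t + (if t == n then G else 0) <=
             stage theta' x t + g ^+ t * K) ->
  (disc_cost theta x + G%:E <= disc_cost theta' x + (K / (1 - g))%:E)%E.
Proof.
move=> G0 K0 h.
have st0 th t : (0 <= (stage th x t)%:E)%E by rewrite lee_fin stage_ge0.
have g0 t : (0 <= (g ^+ t * K)%:E)%E.
  by case/andP: hg => g0 _; rewrite lee_fin mulr_ge0// exprn_ge0// ltW.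
have G0' t : (0 <= (if t == n then G else 0)%:E)%E by case: ifP.
apply: le_trans (leeD2l _ (nneseries_geometric_le K0)).
rewrite -nneseriesD//.
have -> : G%:E = (\sum_(0 <= t <oo) (if t == n then G else 0)%:E)%E.
  rewrite (@nneseriesD1 _ _ n)// eqxx eseries0 ?adde0// => t _.
  by move=> /andP[_ /negbTE->].
rewrite -nneseriesD//; apply: lee_nneseries => [t _ _|t _].
  by rewrite adde_ge0.
by rewrite -!EFinD lee_fin h.
Qed.

End stage_costs.

(** * Measurability of the cost in the starting point *)

Section measurability.
Context (R : realType).

Lemma measurable_tent (a r : R) : 0 < r -> measurable_fun [set: R] (tent a r).
Proof.
move=> r0; rewrite (_ : tent a r = (fun x => Num.max 0 (1 - `|x - a| / r))).
  apply: measurable_maxr; first exact: measurable_cst.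
  apply: measurable_funB; first exact: measurable_cst.
  apply: measurable_funM; last exact: measurable_cst.
  apply: measurableT_comp; first exact: normr_measurable.
  by apply: measurable_funB; [exact: measurable_id|exact: measurable_cst].
by apply/funext => x; rewrite tentE.
Qed.

Lemma measurable_policy (delta : R) theta : 0 < delta ->
  measurable_fun [set: R] (policy delta theta).
Proof.
move=> d0; have d1 : 0 < delta1 R by rewrite /delta1; lra.
rewrite /policy /Fdelta; repeat (apply: measurable_funD || apply: measurable_funM);
  do ?[exact: measurable_cst|exact: measurable_id|exact: measurable_tent
      |exact: normr_measurable].
Qed.

Lemma measurable_disc_cost (delta g Rc : R) theta :
  0 < delta -> 0 < g < 1 -> 0 < Rc < g ->
  measurable_fun [set: measurableTypeR R] (disc_cost delta g Rc theta).
Proof.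
move=> d0 hg hRc; apply: ge0_emeasurable_sum => [t x _ _|t _].
  by rewrite lee_fin stage_ge0.
apply/measurable_EFinP.
have mtraj s : measurable_fun [set: R] (fun x => traj delta theta x s).
  elim: s => [|s ih]; first exact: measurable_id.
  rewrite (_ : (fun x => _) = policy delta theta \o (fun x => traj delta theta x s)).
    by apply: measurableT_comp => //; exact: measurable_policy.
  by apply/funext => x /=; rewrite trajS.
(* Controls are read as next states, so measurability of the states suffices. *)
rewrite /stage; under eq_fun do rewrite -trajS.
apply: measurable_funM; first exact: measurable_cst.
by apply: measurable_funD; (apply: measurable_funM;
  [exact: measurable_cst|apply: measurable_funX; exact: mtraj]).
Qed.

End measurability.

(** * Integration against the initial distribution *)

Section integral_mu0.
Context (R : realType) (eps : {i01 R}) (x0 y0 : R).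
Local Notation T := (measurableTypeR R).

Let mI : measurable (`]-5, 5[%classic : set T) := measurable_itv `]-5, 5[.

Lemma ge0_integral_mu0 (f : T -> \bar R) :
  measurable_fun setT f -> (forall x, (0 <= f x)%E) ->
  (\int[mu0 eps x0 y0]_x f x =
    ((1 - eps%:num) / 2)%:E * f x0 + ((1 - eps%:num) / 2)%:E * f y0 +
    (eps%:num / 10)%:E * \int[mrestr lebesgue_measure mI]_x f x)%E.
Proof.
move=> mf f0; rewrite /mu0 2?ge0_integral_measure_add//.
rewrite !ge0_integral_mscale//= !integral_dirac//.
by rewrite !diracT !mul1e.
Qed.

(** The pointwise comparisons are averaged: the gains at the two atoms must pay for the loss [K1]
    there and for [K2] on the interval, whose total mass is [eps]. *)
Lemma le_integral_mu0 (f h : T -> \bar R) (G1 G2 K1 K2 : R) :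
  measurable_fun setT f -> (forall x, (0 <= f x)%E) ->
  measurable_fun setT h -> (forall x, (0 <= h x)%E) ->
  0 <= K2 ->
  (f x0 + G1%:E <= h x0 + K1%:E)%E -> (f y0 + G2%:E <= h y0 + K1%:E)%E ->
  (forall x, -5 < x < 5 -> (f x <= h x + K2%:E)%E) ->
  (1 - eps%:num) * K1 + eps%:num * K2 <= (1 - eps%:num) / 2 * (G1 + G2) ->
  (\int[mu0 eps x0 y0]_x f x <= \int[mu0 eps x0 y0]_x h x)%E.
Proof.
move=> mf f0 mh h0 K20 hx hy hI hB; rewrite !ge0_integral_mu0//.
set p := (1 - eps%:num) / 2; set nu := mrestr _ _.
have p0 : 0 <= p by rewrite divr_ge0// subr_ge0.
have nuT : nu setT = 10%:E.
  rewrite /nu /mrestr setTI lebesgue_measure_itv /= lte_fin ifT; last by lra.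
  by rewrite -EFinB; congr (_%:E); lra.
have hnu : (\int[nu]_x f x <= \int[nu]_x h x + (10 * K2)%:E)%E.
  have -> : (10 * K2)%:E = (\int[nu]_x (cst K2%:E) x)%E.
    transitivity (K2%:E * nu setT)%E; first by rewrite nuT -EFinM mulrC.
    by rewrite integral_cst.
  rewrite -ge0_integralD//; apply: ae_ge0_le_integral => //.
  - by move=> x _; rewrite adde_ge0// lee_fin.
  - by apply: emeasurable_funD => //; exact: measurable_cst.
  (* The comparison is known only on (-5, 5), whose complement is null for [nu]. *)
  exists (~` `]-5, 5[%classic); split.
  - exact: measurableC.
  - by rewrite /nu /= /mrestr setICl measure0.
  - move=> x /= hn hx'; apply: hn => _; apply: hI.
    by move: hx'; rewrite /= in_itv.
have hK : (1 - eps%:num) * K1 + eps%:num * K2 =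
  p * K1 + p * K1 + eps%:num / 10 * (10 * K2) by rewrite /p; field.
(* Finiteness of the gain allows adding it to both sides without changing the inequality. *)
have fin : (p * G1 + p * G2)%:E \is a fin_num by [].
rewrite -(leeD2rE _ _ fin).
have e0 : 0 <= eps%:num / 10 by rewrite divr_ge0.
have scale (c r s : R) (a b : \bar R) : 0 <= c -> (0 <= a)%E -> (0 <= b)%E ->
    (a + r%:E <= b + s%:E)%E ->
    (c%:E * a + (c * r)%:E <= c%:E * b + (c * s)%:E)%E.
  move=> c0 a0 b0 ab.
  by rewrite !EFinM -!muleDr ?fin_num_adde_defl// lee_wpmul2l// lee_fin.
have hnu' : (\int[nu]_x f x + 0%:E <= \int[nu]_x h x + (10 * K2)%:E)%E.
  by rewrite adde0.
have := leeD (leeD (scale _ _ _ _ _ p0 (f0 _) (h0 _) hx)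
  (scale _ _ _ _ _ p0 (f0 _) (h0 _) hy))
  (scale _ _ _ _ _ e0 (integral_ge0 _ (fun x _ => f0 x))
    (integral_ge0 _ (fun x _ => h0 x)) hnu').
rewrite mulr0 adde0 (addeACA (_ * f x0)%E) (addeAC (_ * f x0 + _)%E).
rewrite (addeACA (_ * h x0)%E) (addeACA (_ * h x0 + _)%E) -!EFinD => /le_trans; apply.
by rewrite leeD2l// lee_fin -hK -mulrDr.
Qed.

End integral_mu0.

(** * Least preimages of the peaks, and the local minimum *)

Lemma minimums_Fdelta (R : realType) (delta a : R) :
  0 < delta <= 1 / 10 -> 0 < a <= 2 ->
  minimums (Fdelta delta @^-1` [set a]) ((a - 63) / (61 / 2)).
Proof.
move=> hd ha.
have rise x : - (21 / 10) <= x <= - 2 -> Fdelta delta x = a ->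
    x = (a - 63) / (61 / 2).
  by move=> hx; rewrite (Fdelta_rise hd)//; lra.
have hx : - (21 / 10) <= (a - 63) / (61 / 2) <= - 2 by lra.
split; first by rewrite /preimage/= (Fdelta_rise hd)//; lra.
(* Left of -21/10 the value is nonpositive, on the rising branch the solution is unique, and right
   of -2 every point exceeds it. *)
move=> x /= Fx; have [x1|x1] := lerP x (- (21 / 10)).
  by have := Fdelta_far hd x1; rewrite Fx; lra.
have [x2|x2] := lerP x (- 2); last by lra.
by rewrite -(rise x) ?lexx// (ltW x1).
Qed.

Theorem proposition3p1 (R : realType) (g Rc : R)
    (hg : 0 < g < 1) (hRc : 0 < Rc < g) :
  exists (delta : R) (eps : {i01 R}) (x0 y0 : R),
    [/\ 0 < delta, 0 < eps%:num,
        minimums (Fdelta delta @^-1` [set a2]) x0,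
        minimums (Fdelta delta @^-1` [set a3]) y0 &
        local_minimum
          (fun theta : R * R =>
             lqr_cost 0 1 1 Rc g (policy delta theta) (mu0 eps x0 y0))
          (0, 1)].
Proof.
have g0 : 0 < g by case/andP: hg.
have g1 : 0 < 1 - g by case/andP: hg => _; rewrite subr_gt0.
(* With this [delta] the gain at time 2 is 700 (|D1| + |D2|) / (1 - g), to be
   compared with the loss of at most 24 d / (1 - g) at each of the two atoms. *)
have [delta deltaE] : exists delta, delta = (g / 10) ^+ 2 * (1 - g) / 70.
  by eexists.
have d0 : 0 < delta by rewrite deltaE divr_gt0// mulr_gt0// exprn_gt0// divr_gt0.
have hd : 0 < delta <= 1 / 10.
  rewrite d0 deltaE /=.
  have : (g / 10) ^+ 2 * (1 - g) <= 1 * 1.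
    by rewrite ler_pM ?sqr_ge0 ?exprn_ile1//; lra.
  by lra.
have [K KE] : exists K, K = 200 * lipF delta ^+ 3 by eexists.
have K0 : 0 <= K.
  rewrite KE; apply: mulr_ge0; first exact: ler0n.
  apply: exprn_ge0.
  exact: le_trans ler01 (lipF_ge1 hd).
(* This choice gives [e * K] = 1 - 2 e, so the averaged loss factor 24 (1 - e) + e K is at most 50
   (1 - e). *)
have [e eE] : exists e, e * (2 + K) = 1.
  by exists (2 + K)^-1; rewrite mulVf// gt_eqF//; lra.
have e0 : 0 < e by rewrite -(@pmulr_lgt0 _ (2 + K)) ?eE ?ltr01//; lra.
have eK0 : 0 <= e * K by rewrite mulr_ge0// ltW.
have e1 : e <= 1 by lra.
pose x0 : R := (a2 - 63) / (61 / 2); pose y0 : R := (a3 - 63) / (61 / 2).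
exists delta, (Itv01 (ltW e0) e1), x0, y0.
have hx0 : minimums (Fdelta delta @^-1` [set a2]) x0.
  by apply: minimums_Fdelta => //; rewrite /a2; lra.
have hy0 : minimums (Fdelta delta @^-1` [set a3]) y0.
  by apply: minimums_Fdelta => //; rewrite /a3; lra.
split => //.
have [[Fx0 _] [Fy0 _]] := (hx0, hy0).
(* Balls of the product bound each coordinate separately, while [pdist] adds the two; hence the
   halved radii. *)
pose rho := Num.min (1 / 200) (delta / 200).
have rho0 : 0 < rho.
  by rewrite lt_min; apply/andP; split; lra.
apply/nbhs_ballP; exists rho; first exact: rho0.
move=> theta [/= b1 b2].
have [h1 h2] : pdist theta <= 1 / 100 /\ pdist theta <= delta / 100.
  move: b1 b2; rewrite -!ball_normE /= sub0r normrN (distrC 1) !lt_min.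
  by move=> /andP[? ?] /andP[? ?]; rewrite /pdist; lra.
set d := pdist theta in h1 h2 *.
have dd : 0 <= d := pdist_ge0 theta.
pose q (x a : R) := g ^+ 2 * (`|traj delta theta x 1 - a| / delta / 10).
have q0 x a : 0 <= q x a.
  by rewrite /q mulr_ge0 ?sqr_ge0// !divr_ge0// ltW.
have st0 th x : (0 <= disc_cost delta g Rc th x)%E.
  by apply: nneseries_ge0 => t _ _; rewrite lee_fin stage_ge0.
change (\int[mu0 (Itv01 (ltW e0) e1) x0 y0]_x disc_cost delta g Rc (0, 1)%R x <=
  \int[mu0 (Itv01 (ltW e0) e1) x0 y0]_x disc_cost delta g Rc theta x)%E.
apply: (@le_integral_mu0 _ _ _ _ _ _ (q x0 a2) (q y0 a3)
  (24 * d / (1 - g)) (K * d / (1 - g))) => //.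
- exact: measurable_disc_cost.
- exact: measurable_disc_cost.
- by rewrite divr_ge0 ?mulr_ge0// ltW.
- apply: (disc_cost_le hg hRc (n := 2)) => //; first by rewrite mulr_ge0.
  move=> t; apply: stage_peak => //; first by rewrite !inE eqxx.
  by rewrite ler_norml /x0 /a2; lra.
- apply: (disc_cost_le hg hRc (n := 2)) => //; first by rewrite mulr_ge0.
  move=> t; apply: stage_peak => //; first by rewrite !inE eqxx orbT.
  by rewrite ler_norml /y0 /a3; lra.
(* No gain is claimed on the interval: [G] is 0, so the index 0 is an arbitrary choice. *)
- move=> x hx.
  rewrite -[leLHS]adde0; apply: (disc_cost_le hg hRc (n := 0)) => //.
    by rewrite mulr_ge0.
  move=> t; rewrite if_same addr0 KE; apply: stage_lip => //.
  by rewrite ler_norml; lra.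
rewrite /=.
set D1 := theta.1 * x0 + (theta.2 - 1) * a2.
set D2 := theta.1 * y0 + (theta.2 - 1) * a3.
have D1E : traj delta theta x0 1 - a2 = D1.
  by rewrite trajS traj0 /policy Fx0 /D1; ring.
have D2E : traj delta theta y0 1 - a3 = D2.
  by rewrite trajS traj0 /policy Fy0 /D2; ring.
(* Cramer's rule with determinant [x0 * a3 - y0 * a2], about -0.62, gives the coefficients 6.2 and
   5.7, both below 7. *)
have dD : d <= 7 * (`|D1| + `|D2|).
  rewrite /d /pdist.
  have := ler_norm D1; have := ler_norm (- D1).
  have := ler_norm D2; have := ler_norm (- D2).
  rewrite !normrN /D1 /D2 /x0 /y0 /a2 /a3.
  by have [?|?] := ler0P theta.1; have [?|?] := ler0P (theta.2 - 1); lra.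
rewrite /q D1E D2E.
have -> : g ^+ 2 * (`|D1| / delta / 10) + g ^+ 2 * (`|D2| / delta / 10) =
    100 * (7 * (`|D1| + `|D2|)) / (1 - g).
  by rewrite deltaE; field; rewrite !gt_eqF.
have -> : (1 - e) * (24 * d / (1 - g)) + e * (K * d / (1 - g)) =
  ((1 - e) * 24 + e * K) * d / (1 - g) by ring.
rewrite !mulrA ler_pM2r ?invr_gt0//.
have : (1 - e) * 50 * d <= (1 - e) * 50 * (7 * (`|D1| + `|D2|)).
  by rewrite ler_wpM2l//; lra.
have : ((1 - e) * 24 + e * K) * d <= (1 - e) * 50 * d.
  by rewrite ler_wpM2r//; lra.
by lra.
Qed.
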